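(* Let $\mathbb{F}_q$ be a finite field, $n\ge1$, and $m_1,\dots,m_n$ nonnegative integers. For $1\le\ell\le n$ let $A_\ell=\{\vec a=(a_1,\dots,a_n)\in\mathbb{N}^n:\ 0\le a_\ell<m_\ell\}$, and let $A=\bigcup_{\ell=1}^nA_\ell$. Let $g\in\mathbb{F}_q[x_1,\dots,x_n]$. Then $(x_1-1)^{m_1}\cdots(x_n-1)^{m_n}$ divides $g$ if and only if $D^{[\vec a]}(g)(1,\dots,1)=0$ for all $\vec a\in A$.
   Context: $\mathbb{N}=\{0,1,2,\dots\}$. Hasse derivative: for $g=\sum d_{i_1,\dots,i_n}x_1^{i_1}\cdots x_n^{i_n}\in\mathbb{F}_q[x_1,\dots,x_n]$ and $\vec a=(a_1,\dots,a_n)\in\mathbb{N}^n$, $$D^{[\vec a]}(g)=\sum d_{i_1,\dots,i_n}\binom{i_1}{a_1}\cdots\binom{i_n}{a_n}x_1^{i_1-a_1}\cdots x_n^{i_n-a_n},$$ where $\binom{i}{a}=0$ whenever $i<a$. $D^{[\vec a]}(g)(1,\dots,1)$ denotes its evaluation at $(1,\dots,1)$. *)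

(* Defs.v *)
From HB Require Import structures.
From mathcomp Require Import all_boot all_order all_algebra.
From mathcomp Require Import mpoly.

Set Implicit Arguments.
Unset Strict Implicit.
Unset Printing Implicit Defensive.

Import GRing.Theory.
Local Open Scope ring_scope.

(* [m - a] is truncated, but 'C(m i, a i) = 0 kills every term of the sum in
   which some a i exceeds m i, so truncation is never visible. *)
Definition hasse (R : comNzRingType) (n : nat) (a : 'X_{1..n})
    (g : {mpoly R[n]}) : {mpoly R[n]} :=
  \sum_(m <- msupp g)
    (g@_m * \prod_(i < n) ('C(m i, a i))%:R) *: 'X_[(m - a)%MM].

Definition mpdvd (R : comNzRingType) (n : nat) (p g : {mpoly R[n]}) : Prop :=
  exists h : {mpoly R[n]}, g = p * h.

Definition slab (n : nat) (m : 'I_n -> nat) (l : 'I_n) (a : 'X_{1..n}) : Prop :=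
  (a l < m l)%N.

Definition slab_union (n : nat) (m : 'I_n -> nat) (a : 'X_{1..n}) : Prop :=
  exists l : 'I_n, slab m l a.

(* Main.v *)
Require Import Defs.
From HB Require Import structures.
From mathcomp Require Import all_boot all_order all_algebra.
From mathcomp Require Import mpoly.

Import GRing.Theory.
Local Open Scope ring_scope.

(* Substituting X_i + 1 for X_i is a ring automorphism.  It carries
   prod_i (X_i - 1)^(m i) to the monomial prod_i X_i^(m i), and by the binomial
   theorem the coefficient of X^a in the image of g is (hasse a g)(1,...,1).
   A monomial X^m divides a polynomial exactly when every X^a with a i < m i
   for some i has coefficient 0 in it. *)

Definition translate {R : comNzRingType} {n : nat} (c : R)
    (p : {mpoly R[n]}) : {mpoly R[n]} :=
  p \mPo [tuple 'X_i + c%:MP | i < n].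

Section Translate.
Context {R : comNzRingType} {n : nat}.
Implicit Types (c : R) (p q : {mpoly R[n]}) (k a : 'X_{1..n}).

Lemma translateM c p q : translate c (p * q) = translate c p * translate c q.
Proof. exact: rmorphM. Qed.

Lemma translateXU c i : translate c ('X_i : {mpoly R[n]}) = 'X_i + c%:MP.
Proof. by rewrite /translate comp_mpolyXU -tnth_nth tnth_mktuple. Qed.

Lemma translateX c k :
  translate c 'X_[k] = \prod_(i < n) ('X_i + c%:MP) ^+ k i.
Proof.
rewrite /translate comp_mpolyX.
by apply: eq_bigr => i _; rewrite tnth_mktuple.
Qed.

(** Substitution is linear and multiplicative, so after expanding [p] into monomials it is enough to
    check each variable, where [c] and [- c] cancel. *)
Lemma translateK c : cancel (@translate R n c) (translate (- c)).
Proof.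
move=> p; rewrite /translate [p \mPo _]comp_mpolyEX raddf_sum [RHS]mpolyE /=.
apply: eq_bigr => k _; rewrite comp_mpolyZ; congr (_ *: _).
rewrite -![_ \mPo _]/(translate _ _) translateX [LHS]rmorph_prod /= [RHS]mpolyXE_id.
apply: eq_bigr => i _; rewrite rmorphXn /=; congr (_ ^+ _).
rewrite comp_mpolyD comp_mpolyC -[_ \mPo _]/(translate _ _) translateXU.
by rewrite mpolyCN addrNK.
Qed.

Lemma mcoeff_prod_XD1 k a :
  (\prod_(i < n) ('X_i + 1) ^+ k i : {mpoly R[n]})@_a
    = (\prod_(i < n) 'C(k i, a i))%:R.
Proof.
(* A common strict bound on all [k i] and [a i]: the binomial sums then share the index type ['I_N],
   so their product can be distributed over functions into ['I_N], one of which is [a]. *)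
pose N := (mdeg k + mdeg a).+1.
have ltN (b : 'X_{1..n}) i : (mdeg b < N)%N -> (b i < N)%N.
  by apply: leq_ltn_trans; rewrite mdegE (bigD1 i) //= leq_addr.
have {}ltN : (forall i, (k i < N)%N) * (forall i, (a i < N)%N).
  by split=> i; apply: ltN; rewrite ltnS ?leq_addr ?leq_addl.
have expand i : ('X_i + 1) ^+ k i
    = \sum_(j < N) 'X_i ^+ j *+ 'C(k i, j) :> {mpoly R[n]}.
  pose term j := 1 ^+ (k i - j) * 'X_i ^+ j *+ 'C(k i, j) : {mpoly R[n]}.
  (* The terms added with [k i < j < N] vanish because ['C(k i, j)] does. *)
  rewrite addrC exprDn (big_ord_widen _ term (ltN.1 i)) big_mkcond.
  apply: eq_bigr => j _; rewrite /term expr1n mul1r ltnS.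
  by case: leqP => // /bin_small ->; rewrite mulr0n.
under eq_bigr do rewrite expand.
rewrite bigA_distr_bigA /= raddf_sum /=.
(* [f0] is [a] seen as a function into ['I_N], the only choice of exponents that contributes to
   ['X_[a]]. *)
pose f0 := [ffun i => Ordinal (ltN.2 i)].
have coefE (f : {ffun 'I_n -> 'I_N}) :
    (\prod_i ('X_i ^+ f i *+ 'C(k i, f i)) : {mpoly R[n]})@_a
      = (f == f0)%:R *+ \prod_i 'C(k i, f i).
  have -> : \prod_i ('X_i ^+ f i *+ 'C(k i, f i))
      = 'X_[[multinom f i : nat | i < n]] *+ \prod_i 'C(k i, f i) :> {mpoly R[n]}.
    rewrite prodrMn [X in _ = X *+ _]mpolyXE_id; congr (_ *+ _).
    by apply: eq_bigr => i _; rewrite mnmE.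
  rewrite mcoeffMn mcoeffX; congr (_%:R *+ _); congr nat_of_bool.
  apply/eqP/eqP => [/mnmP fa|->].
    by apply/ffunP => i; apply/val_inj; rewrite ffunE /= -fa mnmE.
  by apply/mnmP => i; rewrite mnmE ffunE.
rewrite (eq_bigr _ (fun f _ => coefE f)) (bigD1 f0) //= [X in _ + X]big1.
  by rewrite eqxx addr0; congr (_%:R); apply: eq_bigr => i _; rewrite ffunE.
by move=> f /negPf->; rewrite mul0rn.
Qed.

(** By linearity this reduces to monomials: at the all-ones point ['X_[(k - a)]] becomes 1, leaving
    just the product of binomials given by [mcoeff_prod_XD1]. *)
Lemma hasse_meval1 a p :
  (hasse a p).@[fun=> 1] = (translate 1 p)@_a.
Proof.
rewrite /translate comp_mpolyEX /hasse !raddf_sum /=.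
apply: eq_bigr => k _; rewrite mevalZ mevalX mcoeffZ.
rewrite -[_ \mPo _]/(translate _ _) translateX mpolyC1 mcoeff_prod_XD1.
rewrite natr_prod [X in _ * X = _]big1 ?mulr1 // => i _; exact: expr1n.
Qed.

Lemma mpdvdXP k p :
  mpdvd 'X_[k] p <-> (forall a, ~~ (k <= a)%MM -> p@_a = 0).
Proof.
split=> [[h ->] a nka|p0].
  apply/memN_msupp_eq0/negP => /msuppM_le /allpairsP[[b b']] /= [].
  rewrite msuppX inE => /eqP-> _ aE.
  by rewrite aE lem_addr in nka.
(* The quotient shifts each exponent down by [k]. The truncated subtraction is exact, since the
   hypothesis forces [k <= a] on the support. *)
exists (\sum_(a <- msupp p) p@_a *: 'X_[(a - k)%MM]).
rewrite [LHS]mpolyE mulr_sumr; apply: eq_big_seq => a.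
rewrite mcoeff_msupp => pa; rewrite -scalerAr -mpolyXD addmC submK //.
by apply: contraR pa => /p0 ->.
Qed.

Lemma mpdvd_translate c p q : mpdvd p q -> mpdvd (translate c p) (translate c q).
Proof. by case=> h ->; exists (translate c h); rewrite translateM. Qed.

End Translate.

Theorem theorem5p2 (F : finFieldType) (n : nat) (n_gt0 : (0 < n)%N)
    (m : 'I_n -> nat) (g : {mpoly F[n]}) :
  mpdvd (\prod_(i < n) ('X_i - 1) ^+ m i) g
  <-> (forall a : 'X_{1..n}, slab_union m a ->
         (hasse a g).@[fun _ : 'I_n => 1] = 0).
Proof.
pose k := [multinom m i | i < n].
have prodE : \prod_(i < n) ('X_i - 1) ^+ m i
    = translate (- 1) 'X_[k] :> {mpoly F[n]}.
  by rewrite translateX; apply: eq_bigr => i _; rewrite mnmE mpolyCN mpolyC1.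
(* The union of slabs is the complement of the cone of exponents above [k], which matches the
   condition in [mpdvdXP]. *)
have slabE a : slab_union m a <-> ~~ (k <= a)%MM.
  split=> [[l lt_al]|].
    by apply/mnm_lepP => /(_ l); rewrite mnmE leqNgt lt_al.
  rewrite negb_forall => /existsP[l]; rewrite mnmE -ltnNge.
  by exists l.
have -> : mpdvd (\prod_(i < n) ('X_i - 1) ^+ m i) g
    <-> mpdvd 'X_[k] (translate 1 g).
  rewrite prodE; split=> /mpdvd_translate.
    (* Writing 1 as [- (- 1)] lets [translateK] apply with [c] equal to [- 1]. *)
    by move=> /(_ 1); rewrite -{1}(opprK 1) translateK.
  by move=> /(_ (- 1)); rewrite translateK.
rewrite mpdvdXP; split=> g0 a /slabE aP; first by rewrite hasse_meval1 g0.
by rewrite -hasse_meval1 g0.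
Qed.
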